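(* There exist a commutative unital ring $R$ and a spectral subspace $X$ of the real spectrum of $R$ such that $X$ is not homeomorphic to the Brumfiel spectrum of any commutative $f$-ring (thus $X$ is also not homeomorphic to the real spectrum of any commutative unital ring).
   Context: ''Compact'' does not include Hausdorff. A topological space is sober if every join-irreducible member of the lattice of its closed subsets is the closure of a unique singleton. It is generalized spectral if it is sober, its compact open subsets form a basis, and the intersection of any two compact open subsets is compact; it is spectral if moreover it is compact. A map between topological spaces is spectral if the inverse image of every compact open set is compact open. A generalized spectral space $X$ is a spectral subspace of a generalized spectral space $Y$ if $X\subseteq Y$, $X$ carries the topology induced by $Y$, and the inclusion map $X\to Y$ is spectral. A lattice-ordered ring is a ring (not necessarily unital) with a lattice ordering invariant under additive translations and preserved by multiplication by positive elements; it is an $f$-ring if for all $x,y,z\geq 0$, $x\wedge y=0$ implies $x\wedge yz=x\wedge zy=0$. An $\ell$-ideal of an $f$-ring is a ring ideal that is also an order-convex sublattice. A prime $\ell$-ideal of a commutative $f$-ring is a proper $\ell$-ideal $P$ that is prime as a ring ideal. The Brumfiel spectrum of a commutative $f$-ring $A$ is the set of all its prime $\ell$-ideals, with closed sets exactly the sets $\{P: I\subseteq P\}$ for $I\subseteq A$. For a commutative unital ring $R$, a cone is a subset that is both an additive and a multiplicative submonoid of $R$ and contains all squares. A cone $P$ is prime if $R=P\cup(-P)$ and $P\cap(-P)$ is a prime ideal of $R$. The real spectrum of $R$ is the set of all prime cones of $R$, with the topology generated by the sets $\{P : a\notin P\}$, $a\in R$. *)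

(* Defs.v *)
From HB Require Import structures.
From mathcomp Require Import all_boot all_order all_algebra.
From mathcomp Require Import boolp classical_sets functions topology.

Set Implicit Arguments.
Unset Strict Implicit.
Unset Printing Implicit Defensive.

Import Order.TTheory GRing.Theory Num.Theory.

Local Open Scope classical_set_scope.
Local Open Scope ring_scope.

(** In a lattice with a least element, the least element is not
    join-irreducible; hence the condition that [C] be nonempty. *)
Definition join_irreducible_closed (T : topologicalType) (C : set T) : Prop :=
  [/\ closed C, C !=set0 &
      forall D E : set T, closed D -> closed E ->
        C = D `|` E -> C = D \/ C = E].

Definition sober (T : topologicalType) : Prop :=
  forall C : set T, join_irreducible_closed C ->
    exists! x : T, C = closure [set x].

Definition compact_open (T : topologicalType) : set (set T) :=
  [set U | compact U /\ open U].
Arguments compact_open : clear implicits.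

Definition generalized_spectral (T : topologicalType) : Prop :=
  [/\ sober T, basis (compact_open T) & setI_closed (compact_open T)].

Definition spectral_map (T U : topologicalType) (f : T -> U) : Prop :=
  forall V : set U, compact_open U V -> compact_open T (f @^-1` V).

(** [set_type X] carries the topology induced by [Y]. *)
Definition spectral_subspace (Y : topologicalType) (X : set Y) : Prop :=
  [/\ generalized_spectral Y, generalized_spectral (set_type X) &
      spectral_map (set_val : set_type X -> Y)].

Definition homeomorphic (T U : topologicalType) : Prop :=
  exists (f : T -> U) (g : U -> T),
    [/\ cancel f g, cancel g f, continuous f & continuous g].

HB.mixin Record Zmodule_isRng A & GRing.Zmodule A := {
  rng_mul : A -> A -> A;
  rng_mulA : associative rng_mul;
  rng_mulDl : left_distributive rng_mul +%R;
  rng_mulDr : right_distributive rng_mul +%R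
}.

#[short(type="rngType")]
HB.structure Definition Rng := { A of GRing.Zmodule A & Zmodule_isRng A }.

Notation "x ** y" := (rng_mul x y) (at level 40, left associativity)
  : ring_scope.

(** The lattice operations are part of the mixin, because Hierarchy Builder
    rejects a new structure that inherits from both [GRing.Zmodule] and
    [Order.Lattice]: it would compete with [Num.RealDomain] as their join. *)
HB.mixin Record Rng_isLatticeOrdered A & Rng A & Num.POrderedZmodule A := {
  lrng_meet : A -> A -> A;
  lrng_join : A -> A -> A;
  lrng_meetP : forall x y z : A,
    (z <= lrng_meet x y) = (z <= x) && (z <= y);
  lrng_joinP : forall x y z : A,
    (lrng_join x y <= z) = (x <= z) && (y <= z);
  lrng_leD2r : forall z x y : A, x <= y -> x + z <= y + z;
  lrng_leM2l : forall z x y : A, 0 <= z -> x <= y -> z ** x <= z ** y;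
  lrng_leM2r : forall z x y : A, 0 <= z -> x <= y -> x ** z <= y ** z
}.

#[short(type="latticeRngType")]
HB.structure Definition LatticeRng :=
  { A of Rng A & Num.POrderedZmodule A & Rng_isLatticeOrdered A }.

HB.mixin Record LatticeRng_isFRing A & LatticeRng A := {
  fring_meetM : forall x y z : A, 0 <= x -> 0 <= y -> 0 <= z ->
    lrng_meet x y = 0 ->
    lrng_meet x (y ** z) = 0 /\ lrng_meet x (z ** y) = 0
}.

#[short(type="fRingType")]
HB.structure Definition FRing := { A of LatticeRng A & LatticeRng_isFRing A }.

HB.mixin Record Rng_isCommutative A & Rng A := {
  rng_mulC : commutative (@rng_mul A)
}.

#[short(type="comFRingType")]
HB.structure Definition ComFRing := { A of FRing A & Rng_isCommutative A }.

Definition ring_ideal (A : rngType) (I : set A) : Prop :=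
  [/\ I 0, forall x y, I x -> I y -> I (x - y) &
      forall a x, I x -> I (a ** x) /\ I (x ** a)].

Definition l_ideal (A : fRingType) (I : set A) : Prop :=
  [/\ ring_ideal I,
      forall x y z : A, I x -> I z -> x <= y -> y <= z -> I y &
      forall x y : A, I x -> I y -> I (lrng_meet x y) /\ I (lrng_join x y)].

Definition prime_l_ideal (A : comFRingType) (P : set A) : Prop :=
  [/\ l_ideal P, P <> setT & forall x y : A, P (x ** y) -> P x \/ P y].

Record brumfiel_spectrum (A : comFRingType) := BrumfielPoint {
  brumfiel_ideal : set A;
  brumfiel_idealP : prime_l_ideal brumfiel_ideal
}.

Section BrumfielTopology.
Variable A : comFRingType.
Notation spec := (brumfiel_spectrum A).

Definition brumfiel_closed : set (set spec) :=
  [set C | exists I : set A, C = [set P : spec | I `<=` brumfiel_ideal P]].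

Definition brumfiel_open : set (set spec) :=
  [set U | brumfiel_closed (~` U)].

Lemma brumfiel_openT : brumfiel_open setT.
Proof.
exists setT; rewrite setCT predeqE => P; split=> // TP.
by case: (brumfiel_idealP P) => _ PT _; apply: PT; apply/seteqP; split.
Qed.

Lemma brumfiel_openI : setI_closed brumfiel_open.
Proof.
move=> U V [I UI] [J VJ].
exists [set z | exists x y, [/\ I x, J y & z = x ** y]].
rewrite setCI UI VJ predeqE => P.
case: (brumfiel_idealP P) => -[[_ _ PM] _ _] _ Ppr.
split=> [[IP|JP] z [x] [y] [Ix Jy ->]|IJP].
- by have [] := PM y x (IP _ Ix).
- by have [] := PM x y (JP _ Jy).
- have [IP|nIP] := pselect (I `<=` brumfiel_ideal P); [by left|right=> y Jy].
  move: nIP; rewrite -existsNE => -[x] /not_implyP [Ix nPx].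
  by have [] := Ppr x y (IJP _ (ex_intro _ x (ex_intro _ y (And3 Ix Jy erefl)))).
Qed.

Lemma brumfiel_open_bigU (T : Type) (f : T -> set spec) :
  (forall i, brumfiel_open (f i)) -> brumfiel_open (\bigcup_i f i).
Proof.
move=> /choice[I fI]; exists (\bigcup_i I i).
rewrite setC_bigcup predeqE => P; split=> [fP x [i _ Iix]|IP i _].
  by have := fP i Logic.I; rewrite fI; apply.
by rewrite fI => x Iix; apply: IP; exists i.
Qed.

HB.instance Definition _ := gen_eqMixin spec.
HB.instance Definition _ := gen_choiceMixin spec.
HB.instance Definition _ := @isOpenTopological.Build spec
  brumfiel_open brumfiel_openT brumfiel_openI brumfiel_open_bigU.

End BrumfielTopology.

Definition prime_ideal (R : comPzRingType) (I : set R) : Prop :=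
  [/\ [/\ I 0, forall x y, I x -> I y -> I (x - y) &
          forall a x, I x -> I (a * x)],
      I <> setT & forall x y, I (x * y) -> I x \/ I y].

Definition cone (R : comPzRingType) (P : set R) : Prop :=
  [/\ P 0 /\ (forall x y, P x -> P y -> P (x + y)),
      P 1 /\ (forall x y, P x -> P y -> P (x * y)) &
      forall x, P (x ^+ 2)].

Definition prime_cone (R : comPzRingType) (P : set R) : Prop :=
  [/\ cone P, setT = P `|` -%R @` P & prime_ideal (P `&` -%R @` P)].

Record real_spectrum (R : comPzRingType) := RealPoint {
  real_cone : set R;
  real_coneP : prime_cone real_cone
}.

Section RealTopology.
Variable R : comPzRingType.
Notation spec := (real_spectrum R).

HB.instance Definition _ := gen_eqMixin spec.
HB.instance Definition _ := gen_choiceMixin spec.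
HB.instance Definition _ := @isSubBaseTopological.Build spec (set spec)
  (range (fun a : R => [set P : spec | ~ real_cone P a])) id.

End RealTopology.

(* Main.v *)
From HB Require Import structures.
From mathcomp Require Import all_boot all_order all_algebra.
From mathcomp Require Import finmap boolp classical_sets functions cardinality.
From mathcomp Require Import filter topology.
Require Import Defs.

(** Real spectra and Brumfiel spectra are both spaces of prime cones [c(t)] in
    commutative rings, possibly without unit. Let [X] be the space, inside a
    real spectrum, of a 3-chain of prime cones [l0 < l1 < l2] that is the limit of
    uncountably many 2-chains [o0 i < o2 i], with [o0 i] tending to [l0] and
    to [l1], and [o2 i] to [l2]; it is the patch closed set of the points
    [(i, 0), (i, 2), (oo, 0), (oo, 1), (oo, 2)] of the real spectrum of the ring
    of eventually constant families in Z[t][s], ordered by 0 < s << t << 1.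

    Suppose that [X] is a space of prime cones. Choose [a] in the support of
    [c(l1)] and positive at [l0], [b] in the support of [c(l2)] and positive at
    [l1], and [d] positive at [l2]. For all but finitely many [i], [a] and [b]
    are positive at [o0 i], [b] is in the support of [c(o2 i)] and [d] is
    positive at [o2 i]. No prime cone lies strictly between [c(o0 i)] and
    [c(o2 i)], so [b^n <= c a] at [o0 i] for some [n] and [c]; since [b c] is
    infinitely small compared to [d], [b^(n+1) <= d a] at [o0 i]. The multiplier
    [d] no longer depends on [i], so the same [n] works for infinitely many
    [i], and [b^(n+1) <= d a] at the limit [l0]. Hence [b] is in the support of
    [c(l1)], a contradiction. *)

Set Implicit Arguments.
Unset Strict Implicit.
Unset Printing Implicit Defensive.

Import Order.TTheory GRing.Theory Num.Theory.

Local Open Scope classical_set_scope.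
Local Open Scope ring_scope.

(** * Ultrafilters, patch limits and spectral spaces *)

Lemma ultra_fmap (S T : Type) (f : S -> T) (U : set_system S) :
  UltraFilter U -> UltraFilter (f @ U).
Proof.
move=> UU; split=> [|G GF UG]; first exact: fmap_proper_filter.
apply/seteqP; split=> // V GV; rewrite /fmap /=.
have [//|UnV] := in_ultra_setVsetC (f @^-1` V) UU.
have /UG GnV : (f @ U) (~` V) by [].
by have /filter_ex[x []] : G (V `&` ~` V) by exact: filterI.
Qed.

Lemma ultra_setC (T : Type) (U : set_system T) (V : set T) :
  UltraFilter U -> U (~` V) <-> ~ U V.
Proof.
move=> UU; split=> [UnV UV|nUV]; last by have [] := in_ultra_setVsetC V UU.
by have /filter_ex[x []] : U (V `&` ~` V) by exact: filterI.
Qed.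

(** The second clause says, in terms of filters, that the finite intersections of the sets [D a]
    form a basis. *)
Definition subbase (T : topologicalType) (A : Type) (D : A -> set T) : Prop :=
  (forall a, open (D a)) /\
  forall (F : set_system T) (t : T), Filter F ->
    (forall a, D a t -> F (D a)) -> F --> t.

(** For an ultrafilter [F] this is convergence in the patch topology, which is generated by the
    [D a] and their complements. *)
Definition patch_limit (T A : Type) (D : A -> set T) (F : set_system T)
    (t : T) : Prop :=
  forall a, D a t <-> F (D a).

Section Subbase.
Variables (T : topologicalType) (A : Type) (D : A -> set T).
Hypothesis DT : subbase D.

Lemma subbase_open_transfer (W : set T) (s t : T) :
  open W -> W t -> (forall a, D a t -> D a s) -> W s.
Proof.
move=> oW Wt st.
have st_cvg : principal_filter s --> t.
  by apply: DT.2 => a Dat; apply/principal_filterP; exact: st.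
have /principal_filterP// : principal_filter s W.
by apply: st_cvg; exact: open_nbhs_nbhs.
Qed.

Lemma patch_limit_cvg (F : set_system T) (t : T) {FF : Filter F} :
  patch_limit D F t -> F --> t.
Proof. by move=> Ft; apply: DT.2 => a /Ft. Qed.

Lemma subbase_preimage (X : set T) :
  subbase (fun a => (set_val : X -> T) @^-1` D a).
Proof.
split=> [a|F t FF DF V]; first by exists (D a) => //; exact: DT.1.
rewrite nbhsE => -[W [[W' oW' <-] W't] WV].
apply: filterS WV _.
have /(_ W') : (set_val : X -> T) @ F --> set_val t by apply: DT.2 => a /DF.
by apply; exact: open_nbhs_nbhs.
Qed.

Hypothesis D_ultra :
  forall U : set_system T, UltraFilter U -> exists t, patch_limit D U t.

(** [D_ultra] makes the patch topology compact, and the compact open sets become the open sets that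
    are patch clopen. If a compact open [W] belongs to [U], then [U] has a limit [s] in [W]; the
    patch limit [t] lies in each [D a] that contains [s], hence in [W]. *)
Lemma compact_openP (W : set T) : compact_open T W <->
  open W /\
  forall U t, UltraFilter U -> patch_limit D U t -> (W t <-> U W).
Proof.
split=> [[cW oW]|[oW WU]]; split=> //.
  move=> U t UU Ut; split=> [Wt|UW].
    by apply: (patch_limit_cvg Ut); apply: open_nbhs_nbhs.
  have := cW; rewrite compact_ultra => /(_ U UU UW)[s [Ws Us]].
  apply: (subbase_open_transfer oW Ws) => a Das.
  by apply/Ut/Us/open_nbhs_nbhs; split=> //; exact: DT.1.
rewrite compact_ultra => U UU UW; have [t Ut] := D_ultra UU.
by exists t; split; [apply/(WU U t)|exact: patch_limit_cvg].
Qed.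

Lemma compact_open_subbase (a : A) : compact_open T (D a).
Proof.
by apply/compact_openP; split=> [|U t _ Ut]; [exact: DT.1|exact: Ut].
Qed.

Lemma compact_openI : setI_closed (compact_open T).
Proof.
move=> V W /compact_openP[oV VU] /compact_openP[oW WU].
apply/compact_openP; split=> [|U t UU Ut]; first exact: openI.
split=> [[/(VU U t UU Ut) ? /(WU U t UU Ut) ?]|UVW]; first exact: filterI.
split; [apply/(VU U t UU Ut)|apply/(WU U t UU Ut)];
  by apply: filterS UVW => x [].
Qed.

Lemma compact_openT : compact_open T setT.
Proof.
apply/compact_openP; split=> [|U t UU _]; first exact: openT.
by split=> // _; exact: filterT.
Qed.

Lemma compact_open_basis : basis (compact_open T).
Proof.
split=> [W []//|x]; apply: DT.2.
  apply: filter_from_filter; first exists setT => //.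
    by split=> //; exact: compact_openT.
  move=> V W [cV Vx] [cW Wx]; exists (V `&` W) => //.
  by split=> //; exact: compact_openI.
by move=> a Dax; exists (D a) => //; split=> //; exact: compact_open_subbase.
Qed.

Hypothesis D_inj : forall s t, (forall a, D a s <-> D a t) -> s = t.

(** Irreducibility makes the traces on [C] of the open sets meeting [C] a filter base. The patch
    limit of an ultrafilter above it lies in [C] and in every [D a] that meets [C], so it is a
    generic point. *)
Lemma subbase_sober : sober T.
Proof.
move=> C [clC [x0 Cx0] Cirr].
pose G : set_system T :=
  [set V | exists O, [/\ open O, C `&` O !=set0 & C `&` O `<=` V]].
have GF : ProperFilter G.
  apply: Build_ProperFilter_ex => [V [O [_ [x CO] OV]]|].
    by exists x; exact: OV.
  split=> [|V W [O [oO CO OV]] [O' [oO' CO' OW]]|V W VW [O [oO CO OV]]].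
  - by exists setT; split=> //; [exact: openT|exists x0].
  - exists (O `&` O'); split; first exact: openI.
      apply: contrapT => nCOO'.
      have : C = (C `&` ~` O) `|` (C `&` ~` O').
        apply/seteqP; split=> [y Cy|y [[]|[]]//].
        have [Oy|nOy] := pselect (O y); last by left.
        by right; split=> // O'y; apply: nCOO'; exists y.
      have clD (Z : set T) : open Z -> closed (C `&` ~` Z).
        by move=> oZ; apply: closedI => //; exact: open_closedC.
      move=> /(Cirr _ _ (clD _ oO) (clD _ oO'))[CE|CE].
        by have [y [+ Oy]] := CO; rewrite CE => -[].
      by have [y [+ Oy]] := CO'; rewrite CE => -[].
    by move=> y [Cy [Oy O'y]]; split; [exact: OV|exact: OW].
  - by exists O; split=> //; exact: subset_trans VW.
have [U [UU GU]] := ultraFilterLemma GF.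
have [t Ut] := D_ultra UU.
have UC : U C.
  by apply: GU; exists setT; split=> [||y []//]; [exact: openT|exists x0].
have Ct : C t.
  have /closure_id -> := clC => B tB.
  have UB : U B by exact: (patch_limit_cvg Ut).
  exact: filter_ex (filterI UC UB).
have generic y : C y -> forall a, D a y -> D a t.
  move=> Cy a Day; apply/Ut/GU; exists (D a); split=> //; first exact: DT.1.
  by exists y.
have Ccl s : C = closure [set s] -> (forall a, D a t -> D a s) /\ C s.
  move=> Cs; split; last by rewrite Cs; exact: subset_closure.
  move=> a Dat; have := Ct; rewrite Cs => /(_ (D a)).
  by case=> [|z [->]//]; apply: open_nbhs_nbhs; split=> //; exact: DT.1.
exists t; split=> [|s /Ccl[ts Cs]]; last first.
  by apply: D_inj => a; split=> [/ts//|]; exact: generic.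
apply/seteqP; split=> [y Cy B|].
  rewrite nbhsE => -[O [oO Oy] OB]; exists t; split=> //; apply: OB.
  by apply: (subbase_open_transfer oO Oy); exact: generic.
by rewrite closureE => y; apply; split=> // z ->.
Qed.

Lemma subbase_generalized_spectral : generalized_spectral T.
Proof.
by split; [exact: subbase_sober|exact: compact_open_basis|exact: compact_openI].
Qed.

End Subbase.

(** The last hypothesis says that [X] is patch closed. The traces of the [D a] then satisfy the same
    hypotheses on [X], and the inclusion pulls patch clopen sets back to patch clopen sets. *)
Lemma spectral_subspace_patch (T : topologicalType) (A : Type)
    (D : A -> set T) (X : set T) :
  subbase D ->
  (forall s t, (forall a, D a s <-> D a t) -> s = t) ->
  (forall U, UltraFilter U -> exists t, patch_limit D U t) ->
  (forall U : set_system X, UltraFilter U ->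
     exists t : X, patch_limit D (set_val @ U) (set_val t)) ->
  spectral_subspace X.
Proof.
move=> DT Dinj DU DX.
have DXU (U : set_system X) : UltraFilter U ->
    exists t, patch_limit (fun a => (set_val : X -> T) @^-1` D a) U t.
  by move=> /DX.
split.
- exact: subbase_generalized_spectral DT DU Dinj.
- apply: subbase_generalized_spectral (subbase_preimage DT X) DXU _.
  by move=> s t st; apply/val_inj/Dinj.
- move=> V /(compact_openP DT DU)[oV VU].
  apply/(compact_openP (subbase_preimage DT X) DXU); split; first by exists V.
  by move=> U t UU Ut; apply: (VU (set_val @ U)) => //; exact: ultra_fmap.
Qed.

(** * Prime cones in commutative rings, possibly without unit *)

Section PrimePositiveCones.
Variables (A : zmodType) (m : A -> A -> A).
Local Notation "x · y" := (m x y) (at level 40, left associativity).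

Definition support (P : set A) : set A := [set x | P x /\ P (- x)].

(** A form of prime cones that makes sense without a unit: totality and products put the squares in
    [P], and properness is stated with an arbitrary element in place of [- 1]. Below, [~ P (- x)]
    expresses that [x] is positive at [P]. *)
Record prime_positive_cone (P : set A) : Prop := PrimePositiveCone {
  ppcD : forall x y, P x -> P y -> P (x + y);
  ppcM : forall x y, P x -> P y -> P (x · y);
  ppc_total : forall x, P x \/ P (- x);
  ppc_proper : exists x, ~ P x;
  ppc_prime : forall x y, support P (x · y) -> support P x \/ support P y
}.

Hypotheses (mA : associative m) (mC : commutative m)
  (mDl : left_distributive m +%R).

Lemma mul_addr x y z : x · (y + z) = x · y + x · z.
Proof. by rewrite mC mDl !(mC _ x). Qed.

Lemma mul_oppl x y : (- x) · y = - (x · y).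
Proof.
have m0 : 0 · y = 0 by apply: (addrI (0 · y)); rewrite -mDl !addr0.
by apply/eqP; rewrite -addr_eq0 -mDl addNr m0.
Qed.

Lemma mul_oppr x y : x · (- y) = - (x · y).
Proof. by rewrite mC mul_oppl mC. Qed.

Section OneCone.
Variable P : set A.
Hypothesis coneP : prime_positive_cone P.

Lemma ppc0 : P 0.
Proof. by have [//|] := ppc_total coneP 0; rewrite oppr0. Qed.

Lemma ppc_notN x : ~ P x -> P (- x).
Proof. by have [|//] := ppc_total coneP x. Qed.

Lemma ppc_Nnot x : ~ P (- x) -> P x.
Proof. by have [//|] := ppc_total coneP x. Qed.

Lemma ppc_half x : P (x + x) -> P x.
Proof.
move=> P2x; have [//|PNx] := ppc_total coneP x.
by rewrite -(addrK x x); exact: ppcD.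
Qed.

Lemma ppc_addK x y : P (x + y) -> P (- y) -> P x.
Proof. by move=> Pxy PNy; rewrite -(addrK y x); exact: ppcD. Qed.

Lemma ppc_cancel x y : P (x · y) -> ~ P (- x) -> P y.
Proof.
move=> Pxy PNx; have [//|PNy] := ppc_total coneP y.
have : support P (x · y).
  by split=> //; rewrite -mul_oppr; apply: ppcM => //; exact: ppc_Nnot.
by case/(ppc_prime coneP) => -[].
Qed.

Lemma ppc_mulpos x y : ~ P (- x) -> ~ P (- y) -> ~ P (- (x · y)).
Proof. by move=> Nx Ny; rewrite -mul_oppr => /ppc_cancel/(_ Nx). Qed.

Lemma support_mull x y : support P y -> support P (x · y).
Proof.
move=> [Py PNy]; have [Px|PNx] := ppc_total coneP x.
  by split; [|rewrite -mul_oppr]; exact: ppcM.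
split; last by rewrite -mul_oppl; exact: ppcM.
by rewrite -(opprK x) mul_oppl -mul_oppr; exact: ppcM.
Qed.

Lemma supportN x : support P x -> support P (- x).
Proof. by move=> [Px PNx]; split=> //; rewrite opprK. Qed.

Lemma supportD x y : support P x -> support P y -> support P (x + y).
Proof. by move=> [? ?] [? ?]; split; rewrite ?opprD; exact: ppcD. Qed.

(* [b]^(n+1): there is no unit for [b]^0. *)
Definition spow (b : A) (n : nat) : A := iter n (m b) b.

Lemma spowS b n : spow b n.+1 = b · spow b n.
Proof. by []. Qed.

Lemma spow_mul b k n : spow b k · spow b n = spow b (k + n).+1.
Proof. by elim: k => // k IHk; rewrite spowS -mA IHk addSn. Qed.

Lemma spow_pos b n : ~ P (- b) -> ~ P (- spow b n).
Proof. by move=> Nb; elim: n => // n; exact: ppc_mulpos. Qed.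

End OneCone.

Section Gap.
Variables (P0 P2 : set A) (a b d : A).
Hypotheses (coneP0 : prime_positive_cone P0) (coneP2 : prime_positive_cone P2).
Hypotheses (P02 : P0 `<=` P2).
Hypotheses (a_pos : ~ P0 (- a)) (b_pos : ~ P0 (- b)) (bP2 : P2 (- b))
  (d_pos : ~ P2 (- d)).

(* If no prime cone lies strictly between [P0] and [P2], then this one is [P0],
   since it omits [- b]. *)
Definition infinitesimal_cone : set A :=
  [set x | forall c n, P0 c -> P0 (spow b n + c · x)].
Local Notation Q := infinitesimal_cone.

Let P0d : P0 d.
Proof. by apply: (ppc_Nnot coneP0) => /P02. Qed.

Let P0b n : P0 (spow b n).
Proof. exact/(ppc_Nnot coneP0)/(spow_pos coneP0). Qed.

Let supp_b : support P2 b.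
Proof. by split=> //; apply: P02; exact: (P0b 0). Qed.

Lemma sub_infinitesimal_cone : P0 `<=` Q.
Proof. by move=> x P0x c n P0c; exact: ppcD (ppcM _ _ _). Qed.

Lemma infinitesimal_cone_sub : Q `<=` P2.
Proof.
(* At index 0 the power is [b] itself: b + d·x >= 0, and [b] is in the support of [P2]. *)
move=> x /(_ d 0 P0d)/P02; rewrite addrC => /(ppc_addK coneP2)/(_ bP2) P2dx.
exact: ppc_cancel P2dx d_pos.
Qed.

Lemma infinitesimal_coneNb : ~ Q (- b).
Proof.
(* The test with multiplier [d] and power b·b gives b·(b - d) >= 0, so b >= d at [P0] and hence at
   [P2], where [- b] is nonnegative and [d] is positive. *)
move=> /(_ d 1 P0d); rewrite spowS mul_oppr mC -mul_oppl -mDl mC.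
move=> /(ppc_cancel coneP0)/(_ b_pos)/P02; rewrite addrC.
by move=> /(ppc_addK coneP2)/(_ bP2).
Qed.

Lemma infinitesimal_cone_prime : prime_positive_cone Q.
Proof.
split.
- move=> x y Qx Qy c n P0c; apply: (ppc_half coneP0).
  (* The inequalities for [c + c] add up to twice the one wanted for [c]. *)
  have P0cc : P0 (c + c) by exact: ppcD.
  have := ppcD coneP0 (Qx _ n P0cc) (Qy _ n P0cc).
  congr P0; rewrite !mDl mul_addr addrACA [X in _ + X]addrACA.
  by rewrite [RHS]addrACA.
- move=> x y Qx Qy; have [P0x|P0Nx] := ppc_total coneP0 x.
    by move=> c n P0c; rewrite mA; apply: Qy; exact: ppcM.
  have [P0y|P0Ny] := ppc_total coneP0 y.
    by move=> c n P0c; rewrite (mC x) mA; apply: Qx; exact: ppcM.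
  apply: sub_infinitesimal_cone; rewrite -[x]opprK mul_oppl -mul_oppr.
  exact: ppcM.
- move=> x; have [P0x|P0x] := ppc_total coneP0 x; [left|right];
    exact: sub_infinitesimal_cone.
- by exists (- b); exact: infinitesimal_coneNb.
(* Positivity of [x] at the new cone means that some c·x exceeds a power of [b] at [P0]; multiplying
   two such inequalities gives one for x·y. *)
- have key x y : ~ Q (- x) -> ~ Q (- y) -> ~ Q (- (x · y)).
    move=> /existsNP[c /existsNP[n /not_implyP[P0c Nx]]].
    move=> /existsNP[e /existsNP[k /not_implyP[P0e Ny]]].
    pose u := c · x - spow b n; pose v := e · y - spow b k.
    have u_pos : ~ P0 (- u) by rewrite opprB -mul_oppr.
    have v_pos : ~ P0 (- v) by rewrite opprB -mul_oppr.
    move=> /(_ (c · e) (n + k).+1 (ppcM coneP0 P0c P0e)).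
    have cxE : c · x = u + spow b n by rewrite subrK.
    have eyE : e · y = v + spow b k by rewrite subrK.
    have -> : spow b (n + k).+1 + (c · e) · (- (x · y)) =
        - (u · v) + - (u · spow b k + spow b n · v).
      rewrite mul_oppr -mA (mA e) (mC e) -(mA x) mA cxE eyE -spow_mul.
      by rewrite mDl !mul_addr addrA opprD addrCA subrr addr0 -addrA opprD.
    move=> /(ppc_addK coneP0); rewrite opprK => P0uv.
    apply: (ppc_mulpos coneP0 u_pos v_pos); apply: P0uv.
    apply: (ppcD coneP0); apply: (ppcM coneP0) => //; exact: ppc_Nnot.
  move=> x y [Qxy QNxy]; apply: contrapT => /not_orP[Nx Ny].
  have sgn z : ~ support Q z -> ~ Q (- z) \/ ~ Q (- - z).
    by rewrite opprK => /not_andP[]; [right|left].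
  have [Nx'|Nx'] := sgn x Nx; have [Ny'|Ny'] := sgn y Ny;
    by apply: key Nx' Ny' _; rewrite ?mul_oppl ?mul_oppr ?opprK.
Qed.

(** If a power of [b] is at most c·a, the multiplier [c], which varies with the cone, is traded for
    the given [d] at the price of one more factor [b]. *)
Lemma infinitesimal_gap :
  (exists n, P0 (d · a - spow b n)) \/ Q (- a).
Proof.
have [|/existsNP[c /existsNP[n /not_implyP[P0c]]]] := pselect (Q (- a)).
  by right.
move=> /(ppc_notN coneP0); rewrite opprD mul_oppr opprK => ca_b; left.
exists n.+1.
(* b·c is in the support of [P2], where [d] is positive, so d <= b·c cannot hold at [P0]. *)
have : P0 (d - b · c).
  have [//|] := ppc_total coneP0 (d - b · c); rewrite opprB => /P02 P2bcd.
  have [_ P2Nbc] := support_mull coneP2 c supp_b.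
  by case: d_pos; apply: (ppc_addK coneP2 _ P2Nbc); rewrite addrC mC.
move=> /(ppcM coneP0)/(_ (ppc_Nnot coneP0 a_pos)) P0dbca.
have P0bcab := ppcM coneP0 (P0b 0) ca_b.
have := ppcD coneP0 P0dbca P0bcab.
congr P0; rewrite mDl mul_oppl /= mul_addr mul_oppr -mA.
by rewrite [- _ + _]addrC addrA subrK.
Qed.

End Gap.
End PrimePositiveCones.

(** * Spaces of prime cones *)

(** The axioms pass to the limit pointwise, with the dichotomy of ultrafilters for totality and
    primality. Properness requires a single element outside almost all the cones. *)
Lemma ultra_cone (A : zmodType) (m : A -> A -> A) (T : Type) (c : T -> set A)
    (U : set_system T) :
  UltraFilter U -> (forall t, prime_positive_cone m (c t)) ->
  (exists a, U [set t | ~ c t a]) ->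
  prime_positive_cone m [set a | U [set t | c t a]].
Proof.
move=> UU cP [a Ua].
have total x : U [set t | c t x] \/ U [set t | c t (- x)].
  have [|UNx] := in_ultra_setVsetC [set t | c t x] UU; first by left.
  by right; apply: filterS UNx => t; exact: ppc_notN (cP t) _.
split=> /=.
- move=> x y Ux Uy; apply: filterS (filterI Ux Uy) => t [].
  exact: ppcD (cP t) _ _.
- move=> x y Ux Uy; apply: filterS (filterI Ux Uy) => t [].
  exact: ppcM (cP t) _ _.
- exact: total.
- by exists a; apply/(ultra_setC _ UU).
- move=> x y [/= Uxy UNxy].
  have [Ux|Ux] := in_ultra_setVsetC [set t | support (c t) x] UU.
    left; split; apply: filterS Ux => t []//.
  right; split; apply: filterS (filterI Ux (filterI Uxy UNxy)) => t;
    by case=> Nx [/= xy Nxy]; have [//|[]] := ppc_prime (cP t) (conj xy Nxy).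
Qed.

(* Up to points with the same neighbourhoods, [T] is the space of the prime
   positive cones that contain [K], in a commutative ring possibly without
   unit. The real spectrum is the case [K = set0]; in an f-ring, the prime
   l-ideals are the supports of the prime positive cones that contain all
   [x >= 0]. *)
Definition cone_space (T : topologicalType) : Prop :=
  exists (A : zmodType) (m : A -> A -> A) (K : set A) (c : T -> set A),
  [/\ [/\ associative m, commutative m & left_distributive m +%R],
      forall t, prime_positive_cone m (c t) /\ K `<=` c t,
      forall Q, prime_positive_cone m Q -> K `<=` Q -> exists t, c t = Q &
      subbase (fun a => [set t | ~ c t a])].

Lemma homeomorphic_cone_space (T U : topologicalType) :
  homeomorphic T U -> cone_space U -> cone_space T.
Proof.
move=> [f [g [fK gK fc gc]]] [A [m [K [c [mP cP cQ [oD cvgD]]]]]].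
exists A, m, K, (c \o f); split=> //.
- by move=> t; exact: cP.
- by move=> Q /cQ/[apply] -[u <-]; exists (g u) => /=; rewrite gK.
split=> [a|F t FF DF].
  by move/continuousP : fc => /(_ _ (oD a)).
have ft : f @ F --> f t by apply: cvgD => a /DF.
move=> V; rewrite -[t]fK => /(gc (f t))/ft; rewrite /fmap /=.
by rewrite !nbhs_filterE /= => FV; apply: filterS FV => x /=; rewrite fK.
Qed.

Section ConeSpaceCompact.
Variables (T : topologicalType) (A : zmodType) (m : A -> A -> A) (K : set A)
  (c : T -> set A).
Hypotheses (cP : forall t, prime_positive_cone m (c t) /\ K `<=` c t)
  (cQ : forall Q, prime_positive_cone m Q -> K `<=` Q -> exists t, c t = Q)
  (cT : subbase (fun a => [set t | ~ c t a])).

Lemma cone_ultra_limit (U : set_system T) : UltraFilter U ->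
  (exists a, U [set t | ~ c t a]) ->
  exists t, patch_limit (fun a => [set t | ~ c t a]) U t.
Proof.
move=> UU Ua; have QP := ultra_cone UU (fun t => (cP t).1) Ua.
have [|t tQ] := cQ QP.
  by move=> k Kk; apply: filterS filterT => t _; exact: (cP t).2.
exists t => a /=; rewrite tQ /=; split=> [/(ultra_setC _ UU)//|].
by move=> Ua'; apply/(ultra_setC _ UU).
Qed.

Lemma cone_compact (a : A) : compact [set t | ~ c t a].
Proof.
rewrite compact_ultra => U UU Ua; have [|t Ut] := cone_ultra_limit UU.
  by exists a.
by exists t; split; [exact/Ut|exact: (patch_limit_cvg cT Ut)].
Qed.

Lemma cone_specialization (s t : T) :
  (forall W, open W -> W t -> W s) <-> c s `<=` c t.
Proof.
split=> [st a csa|st W oW Wt].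
  by apply: contrapT => Nta; exact: (st _ (cT.1 a) Nta).
by apply: (subbase_open_transfer cT oW Wt) => a /= Nta /st.
Qed.

End ConeSpaceCompact.

(** * The obstruction to being a space of prime cones *)

(** The image under [p] of the cofinite filter on [S]. *)
Lemma cofinite_filter (I : Type) (S : set I) (T : Type) (p : I -> T) :
  Filter [set V : set T | finite_set (S `&` [set i | ~ V (p i)])].
Proof.
split=> /= [|V W fV fW|V W VW].
- by apply: (@sub_finite_set _ _ set0) => // i [_]; apply.
- apply: (@sub_finite_set _ _ ((S `&` [set i | ~ V (p i)]) `|`
                                (S `&` [set i | ~ W (p i)]))).
    by move=> i [Si /not_andP[]]; [left|right].
  by rewrite finite_setU.
- by apply: sub_finite_set => i [Si NW]; split=> // /VW.
Qed.

Section NotConeSpace.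
Variables (T : topologicalType) (I : Type) (o2 o0 : I -> T) (l0 l1 l2 : T).
Hypotheses
  (I_uncountable : ~ countable [set: I])
  (T_cover : forall t, (exists i, t = o0 i \/ t = o2 i) \/
    [\/ t = l0, t = l1 | t = l2])
  (fibre_open : forall i, exists V : set T,
    [/\ open V, V (o2 i), V `<=` [set o0 i; o2 i] &
        forall j, V (o2 j) -> j = i])
  (spec_fibre : forall i W, open W -> W (o2 i) -> W (o0 i))
  (spec01 : forall W, open W -> W l1 -> W l0)
  (spec12 : forall W, open W -> W l2 -> W l1)
  (sep01 : exists V : set T, [/\ open V, V l0 & ~ V l1])
  (sep12 : exists V : set T, [/\ open V, V l1, ~ V l2 & forall i, ~ V (o2 i)])
  (lim0 : forall W, open W -> W l0 -> finite_set [set i | ~ W (o0 i)])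
  (lim2 : forall W, open W -> W l2 -> finite_set [set i | ~ W (o2 i)]).

(** Infinitely many points [o2 i] in [W] would cluster at a point of [W]. Points of a fibre have an
    open neighbourhood with only one [o2 j], and [l0] and [l1] have one with none, so the cluster
    point would be [l2]. *)
Lemma compact_open_lim2 (W : set T) :
  compact W -> open W -> ~ W l2 -> finite_set [set i | W (o2 i)].
Proof.
move=> cW oW NWl2; apply: contrapT => infW.
pose S := [set i | W (o2 i)].
pose F := [set V : set T | finite_set (S `&` [set i | ~ V (o2 i)])].
have FF : ProperFilter F.
  apply: Build_ProperFilter; last exact: cofinite_filter.
  rewrite /F /= => finS; apply: infW; apply: sub_finite_set finS => i Wi.
  by split=> // -[].
have FW : F W by apply: (@sub_finite_set _ _ set0) => // i [].
have FC V : finite_set [set i | V (o2 i)] -> F (~` V).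
  by apply: sub_finite_set => i [_ /contrapT].
have [t [Wt]] := cW F FF FW; rewrite clusterEonbhs => Ft.
have far V : open V -> V t -> ~ finite_set [set i | V (o2 i)].
  move=> oV Vt /FC FNV.
  by have [x []] := Ft _ V FNV (conj oV Vt).
have [V [oV Vl1 _ VN]] := sep12.
have farV : ~ V t.
  move=> Vt; apply: (far V) => //.
  by apply: (@sub_finite_set _ _ set0) => // i /VN.
have [[i ti]|[tl|tl|tl]] := T_cover t.
- have [X [oX X2 XN Xi]] := fibre_open i.
  apply: (far X) => //; last by apply: sub_finite_set (finite_set1 i) => j /Xi.
  by case: ti => -> //; exact: spec_fibre.
- by apply: farV; rewrite tl; exact: spec01.
- by apply: farV; rewrite tl.
- by apply: NWl2; rewrite -tl.
Qed.

Lemma not_cone_space : ~ cone_space T.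
Proof.
move=> [A [m [K [c [[mA mC mDl] cK cQ cT]]]]].
have cP t := (cK t).1.
have spec := cone_specialization cT.
have c01 : c l0 `<=` c l1 by exact/spec.
have c12 : c l1 `<=` c l2 by exact/spec.
have c_fibre i : c (o0 i) `<=` c (o2 i) by apply/spec => W; exact: spec_fibre.
have [a [Na1 Na0]] : exists a, c l1 (- a) /\ ~ c l0 (- a).
  have [V [oV Vl0 NVl1]] := sep01.
  have /nonsubset[x [c1x Nc0x]] : ~ c l1 `<=` c l0.
    by move=> c10; apply: NVl1; exact: (spec l1 l0).2 c10 V oV Vl0.
  by exists (- x); rewrite opprK.
have [b [Nb2 Nb1]] : exists b, c l2 (- b) /\ ~ c l1 (- b).
  have [V [oV Vl1 NVl2 _]] := sep12.
  have /nonsubset[x [c2x Nc1x]] : ~ c l2 `<=` c l1.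
    by move=> c21; apply: NVl2; exact: (spec l2 l1).2 c21 V oV Vl1.
  by exists (- x); rewrite opprK.
have [d Nd2] : exists d, ~ c l2 (- d).
  by have [d Nd] := ppc_proper (cP l2); exists (- d); rewrite opprK.
have Nb0 : ~ c l0 (- b) by move=> /c01.
have oD x := cT.1 x.
have b2_fin : finite_set [set i | ~ c (o2 i) (- b)].
  have := compact_open_lim2 (@cone_compact _ _ _ _ _ cK cQ cT (- b)) (oD (- b)).
  by apply => /(_ Nb2).
have a_fin : finite_set [set i | ~ ~ c (o0 i) (- a)] := lim0 (oD _) Na0.
have b_fin : finite_set [set i | ~ ~ c (o0 i) (- b)] := lim0 (oD _) Nb0.
have d_fin : finite_set [set i | ~ ~ c (o2 i) (- d)] := lim2 (oD _) Nd2.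
pose S n := [set i | c (o0 i) (m d a - spow m b n)].
have bound i : ~ c (o0 i) (- a) -> ~ c (o0 i) (- b) -> c (o2 i) (- b) ->
    ~ c (o2 i) (- d) -> exists n, S n i.
  move=> a0 b0 b2 d2.
  have [//|Qa] :=
    infinitesimal_gap mA mC mDl (cP _) (cP _) (c_fibre i) a0 b0 b2 d2.
  have QP :=
    infinitesimal_cone_prime mA mC mDl (cP _) (cP _) (c_fibre i) b0 b2 d2.
  have Q0 := sub_infinitesimal_cone mC mDl (cP (o0 i)) b0.
  have Q2 := infinitesimal_cone_sub mC mDl (cP _) (cP _) (c_fibre i) b2 d2.
  (* The infinitesimal cone belongs to a point of the neighbourhood of [o2 i] inside the fibre:
     [- a] excludes [o0 i], and [- b] excludes [o2 i]. *)
  have [t tQ] := cQ _ QP (subset_trans (cK (o0 i)).2 Q0).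
  rewrite -tQ in Qa Q0 Q2.
  have [V [oV V2 /(_ t) Vt _]] := fibre_open i.
  have [//|t0|t2] := Vt; first exact: (spec t (o2 i)).2 Q2 V oV V2.
    by rewrite t0 in Qa.
  have : c t (- b) by rewrite t2.
  rewrite tQ.
  by have := infinitesimal_coneNb mC mDl (cP _) (cP _) (c_fibre i) b0 b2 d2.
(* Finitely many exceptions and countably many finite sets [S n] cannot exhaust the uncountable
   [I]. *)
have [n Sn] : exists n, ~ finite_set (S n).
  apply: contrapT => /forallNP Sfin; apply: I_uncountable.
  pose E := [set i | ~ ~ c (o0 i) (- a)] `|` [set i | ~ ~ c (o0 i) (- b)] `|`
    ([set i | ~ c (o2 i) (- b)] `|` [set i | ~ ~ c (o2 i) (- d)]).
  pose F k := if k is Some n then S n else E.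
  apply: (@sub_countable _ _ _ (\bigcup_k F k)).
    apply: subset_card_le => i _.
    have [|NE] := pselect (E i); first by exists None.
    move: NE => /not_orP[/not_orP[/contrapT a0 /contrapT b0]].
    move=> /not_orP[/contrapT b2 /contrapT d2].
    by have [n Sni] := bound i a0 b0 b2 d2; exists (Some n).
  apply: bigcup_countable => // -[n|] _; apply: finite_set_countable.
    by apply: contrapT; exact: Sfin.
  by rewrite /F /E !finite_setU.
have : c l0 (m d a - spow m b n).
  apply: contrapT => /(lim0 (oD _)) fin; apply: Sn.
  by apply: sub_finite_set fin => i Si /(_ Si).
(* As [a] is in the support of [c l1], the inequality makes minus a power of [b] nonnegative there,
   although [b] is positive. *)
move=> /c01 c1dab.
have supp_a : support (c l1) a by split=> //; exact/c01/(ppc_Nnot (cP l0)).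
have [_ Nda] := support_mull mC mDl (cP l1) d supp_a.
have := ppcD (cP l1) c1dab Nda; rewrite addrAC subrr add0r.
exact: (spow_pos mC mDl (cP l1)).
Qed.

End NotConeSpace.

(** * Real spectra as spaces of prime cones *)

Lemma ppc_notN1 (R : comPzRingType) (P : set R) :
  prime_positive_cone *%R P -> ~ P (- 1).
Proof.
move=> coneP PN1; have [x] := ppc_proper coneP; apply.
have P1 : P 1.
  by rewrite -[1]mulr1 -mulrNN; exact: (ppcM coneP).
rewrite -[x]mulr1.
by have [] := support_mull (@mulrC R) (@mulrDl R) coneP x (conj P1 PN1).
Qed.

Section RealSpectrumCones.
Variable R : comPzRingType.

Lemma prime_coneP (P : set R) :
  prime_cone P <-> prime_positive_cone *%R P.
Proof.
have suppE : P `&` -%R @` P = support P.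
  apply/seteqP; split=> x [Px].
    by case=> y Py yx; split=> //; rewrite -yx opprK.
  by move=> PNx; split=> //; exists (- x); rewrite ?opprK.
rewrite /prime_cone suppE; split.
  move=> [[[P0 PD] [P1 PM] _] PT [_ Pproper Pprime]]; split=> //.
    move=> x; have : setT x by []. 
    by rewrite PT => -[|[y Py <-]]; rewrite ?opprK; [left|right].
  apply: contrapT => /forallNP PA; apply: Pproper; apply/seteqP.
  by split=> // x _; split; apply: contrapT; exact: PA.
move=> coneP; have P0 := ppc0 coneP.
have mD := @mulrDl R; have mC := @mulrC R.
have Psq x : P (x * x).
  have [Px|PNx] := ppc_total coneP x; first exact: ppcM.
  by rewrite -mulrNN; exact: ppcM.
split.
- split=> [||x]; last by rewrite expr2.
    by split=> // x y; exact: ppcD coneP x y.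
  by split=> [|x y]; [rewrite -[1]mulr1|exact: ppcM coneP x y].
- apply/seteqP; split=> // x _.
  have [Px|PNx] := ppc_total coneP x; first by left.
  by right; exists (- x); rewrite ?opprK.
- split.
  + split=> [|x y sx sy|a x]; first by split; rewrite ?oppr0.
      by apply: (supportD coneP) => //; exact: supportN.
    exact: (support_mull mC mD coneP).
  + have [x Nx] := ppc_proper coneP; move=> sT; apply: Nx.
    by have [] : support P x by rewrite sT.
  + exact: ppc_prime coneP.
Qed.

Lemma real_subbase :
  subbase (fun a => [set P : real_spectrum R | ~ real_cone P a]).
Proof.
split=> [a|F P FF DF V].
  exists [set [set P : real_spectrum R | ~ real_cone P a]]; last first.
    by rewrite bigcup_set1.
  move=> _ ->; exists [fset [set P : real_spectrum R | ~ real_cone P a]]%fset.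
    by move=> W /fset1P ->; apply/mem_set; exists a.
  by rewrite set_fset1 bigcap_set1.
rewrite nbhsE => -[W [[B BfI <-] [W' BW' W'P]] WV].
have [E Erange EW'] := BfI _ BW'.
apply: filterS (subset_trans (bigcup_sup BW') WV) _.
rewrite -EW' in W'P *; apply: filter_bigI => D DE.
have /set_mem[a _ aD] := Erange _ DE.
by rewrite -aD; apply: DF; move: (W'P _ DE); rewrite -aD.
Qed.

Lemma real_cone_inj : injective (@real_cone R).
Proof.
move=> [P Pcone] [Q Qcone] /= PQ; rewrite PQ in Pcone *.
by congr RealPoint; exact: Prop_irrelevance.
Qed.

Lemma real_cone_space : cone_space (real_spectrum R).
Proof.
exists R, *%R, set0, (@real_cone R); split.
- by split; [exact: mulrA|exact: mulrC|exact: mulrDl].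
- by move=> P; split=> //; exact/prime_coneP/real_coneP.
- by move=> Q /prime_coneP Qcone _; exists (RealPoint Qcone).
- exact: real_subbase.
Qed.

Lemma real_ultra_limit (U : set_system (real_spectrum R)) : UltraFilter U ->
  exists P, patch_limit
    (fun a => [set P : real_spectrum R | ~ real_cone P a]) U P.
Proof.
move=> UU.
apply: (@cone_ultra_limit _ _ *%R set0) => //.
- by move=> P; split=> //; exact/prime_coneP/real_coneP.
- by move=> Q /prime_coneP Qcone _; exists (RealPoint Qcone).
(* [- 1] lies outside every prime cone, so every ultrafilter has a proper limit cone. *)
- exists (- 1); apply: filterS filterT => P _.
  exact/ppc_notN1/prime_coneP/real_coneP.
Qed.

End RealSpectrumCones.

(** * Brumfiel spectra as spaces of prime cones *)

Section FRings.
Variable A : comFRingType.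
Implicit Types x y z : A.
Local Notation "x ⊔ y" := (lrng_join x y) (at level 50, left associativity).
Local Notation "x ⊓ y" := (lrng_meet x y) (at level 50, left associativity).

Definition pos_part x : A := x ⊔ 0.
Local Notation "x ^⁺" := (pos_part x) (at level 2, format "x ^⁺").

Let mDl : left_distributive (@rng_mul A) +%R := @rng_mulDl A.
Let mC : commutative (@rng_mul A) := @rng_mulC A.

Lemma lrng_le_add x y z : (x <= y) = (x + z <= y + z).
Proof.
apply/idP/idP; first exact: lrng_leD2r.
by move=> /(lrng_leD2r (- z)); rewrite !addrK.
Qed.

Lemma lrng_leBrDr x y z : (x <= y - z) = (x + z <= y).
Proof. by rewrite [LHS](lrng_le_add _ _ z) subrK. Qed.

Lemma lrng_leBlDr x y z : (x - z <= y) = (x <= y + z).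
Proof. by rewrite [LHS](lrng_le_add _ _ z) subrK. Qed.

Lemma lrng_gerDl x y : (x + y <= x) = (y <= 0).
Proof. by rewrite [RHS](lrng_le_add _ _ x) add0r addrC. Qed.

Lemma lrng_lerDl x y : (x <= x + y) = (0 <= y).
Proof. by rewrite [RHS](lrng_le_add _ _ x) add0r addrC. Qed.

Lemma lrng_joinl x y : x <= x ⊔ y.
Proof. by have := lexx (x ⊔ y); rewrite lrng_joinP => /andP[]. Qed.

Lemma lrng_joinr x y : y <= x ⊔ y.
Proof. by have := lexx (x ⊔ y); rewrite lrng_joinP => /andP[]. Qed.

Lemma lrng_meetl x y : x ⊓ y <= x.
Proof. by have := lexx (x ⊓ y); rewrite lrng_meetP => /andP[]. Qed.

Lemma lrng_meetr x y : x ⊓ y <= y.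
Proof. by have := lexx (x ⊓ y); rewrite lrng_meetP => /andP[]. Qed.

Lemma lrng_joinD x y z : (x ⊔ y) + z = (x + z) ⊔ (y + z).
Proof.
apply/le_anti/andP; split; last first.
  by rewrite lrng_joinP -!lrng_le_add lrng_joinl lrng_joinr.
by rewrite -lrng_leBrDr lrng_joinP !lrng_leBrDr lrng_joinl lrng_joinr.
Qed.

Lemma pos_part_ge0 x : 0 <= x^⁺.
Proof. exact: lrng_joinr. Qed.

Lemma pos_part_sub x : x^⁺ - (- x)^⁺ = x.
Proof.
apply/eqP; rewrite subr_eq addrC /pos_part lrng_joinD addNr add0r.
apply/eqP/le_anti; rewrite !lrng_joinP !lrng_joinl !lrng_joinr //.
Qed.

Lemma rng_ge0_mul x y : 0 <= x -> 0 <= y -> 0 <= x ** y.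
Proof.
move=> x0 /(lrng_leM2l _ _ _ x0); congr (_ <= _).
by apply: (addrI (x ** 0)); rewrite -rng_mulDr !addr0.
Qed.

(* With [p := x^⁺] and [q := (- x)^⁺], the f-ring axiom, used twice, turns
   [p ⊓ q = 0] into [p ** q ⊓ p ** q = 0]. *)
Lemma pos_part_mul x : x^⁺ ** (- x)^⁺ = 0.
Proof.
set p := x^⁺; set q := (- x)^⁺.
have p0 : 0 <= p := pos_part_ge0 x.
have q0 : 0 <= q := pos_part_ge0 (- x).
have meetC y z : y ⊓ z = z ⊓ y.
  by apply/le_anti/andP; split; rewrite lrng_meetP lrng_meetl lrng_meetr.
have pq : p ⊓ q = 0.
  apply/le_anti/andP; split; last by rewrite lrng_meetP p0.
  suff : p <= p - (p ⊓ q) by rewrite lrng_leBrDr lrng_gerDl.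
  rewrite lrng_joinP !lrng_leBrDr add0r lrng_meetl andbT.
  rewrite -[X in X + _](pos_part_sub x) -/p -/q addrAC lrng_leBlDr addrC.
  by rewrite (addrC p) -lrng_le_add lrng_meetr.
have [ppq _] := fring_meetM _ _ _ p0 q0 p0 pq.
have meet_id y : y ⊓ y = y.
  by apply/le_anti; rewrite lrng_meetl lrng_meetP lexx.
have [_] :=
  fring_meetM _ _ _ (rng_ge0_mul q0 p0) p0 q0 (etrans (meetC _ _) ppq).
by rewrite meet_id mC.
Qed.

Section LIdeal.
Variable P : set A.
Hypothesis PP : prime_l_ideal P.

(** The preimage in [A] of the positive cone of the quotient by [P]. *)
Definition cone_of_ideal : set A := [set x | exists2 y, 0 <= y & P (x - y)].

Lemma cone_of_ideal_support : support cone_of_ideal = P.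
Proof.
have [[[P0 PB PM] Pconv _] _ _] := PP.
have PN x : P x -> P (- x) by move=> Px; rewrite -sub0r; exact: PB.
apply/seteqP; split=> [x [[y y0 Pxy] [z z0 Pxz]]|x Px]; last first.
  by split; exists 0 => //; rewrite subr0 //; exact: PN.
have Pyz : P (y + z).
  have := PN _ (PB _ _ Pxy (PN _ Pxz)).
  by rewrite opprK addrACA subrr add0r -opprD opprK.
have Py : P y.
  by apply: Pconv P0 Pyz y0 _; rewrite lrng_lerDl.
by rewrite -(subrK y x) -[y in _ + y]opprK; apply: PB => //; exact: PN.
Qed.

Lemma sub_pos_part x : x - x^⁺ = - (- x)^⁺.
Proof. by rewrite -{1}[x]pos_part_sub addrAC subrr add0r. Qed.

(** The positive parts of [x] and [- x] have product zero, so the prime ideal [P] contains one of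
    them. Membership in the cone thus becomes a closed condition on [P] in the Brumfiel topology. *)
Lemma cone_of_idealP x : cone_of_ideal x <-> P (- x)^⁺.
Proof.
have [[[P0 PB PM] Pconv _] _ Pprime] := PP.
have PN y : P y -> P (- y) by move=> Py; rewrite -sub0r; exact: PB.
split=> [cx|PNx]; last first.
  by exists x^⁺; [exact: pos_part_ge0|rewrite sub_pos_part; exact: PN].
have [] := Pprime x^⁺ (- x)^⁺ _; first by rewrite pos_part_mul.
  move=> Px; have : support cone_of_ideal x.
    split=> //; exists (- x)^⁺; first exact: pos_part_ge0.
    by rewrite sub_pos_part opprK; exact: PN.
  rewrite cone_of_ideal_support => {}/PB/(_ Px)/PN.
  by rewrite opprB -[X in _ - X]pos_part_sub opprB addrCA subrr addr0.
by [].
Qed.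

Lemma cone_of_ideal_prime : prime_positive_cone (@rng_mul A) cone_of_ideal.
Proof.
have suppE := cone_of_ideal_support.
have [[[P0 PB PM] Pconv _] Pproper Pprime] := PP.
have PN x : P x -> P (- x) by move=> Px; rewrite -sub0r; exact: PB.
have PD x y : P x -> P y -> P (x + y).
  by move=> Px /PN; rewrite -{2}[y]opprK; exact: PB.
split; rewrite ?suppE //.
- move=> x y [x' x0 Px] [y' y0 Py]; exists (x' + y').
    by apply: le_trans x0 _; rewrite lrng_lerDl.
  by rewrite opprD addrACA; exact: PD.
- move=> x y [x' x0 Px] [y' y0 Py]; exists (x' ** y').
    exact: rng_ge0_mul.
  have -> : x ** y - x' ** y' = (x - x') ** y + x' ** (y - y').
    rewrite mDl (mul_oppl mDl) (mul_addr mC mDl) (mul_oppr mC mDl).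
    by rewrite addrA subrK.
  by apply: PD; [exact: (PM y _ Px).2|exact: (PM x' _ Py).1].
- move=> x.
  have [] := Pprime x^⁺ (- x)^⁺ _; first by rewrite pos_part_mul.
    by move=> Px; right; apply/cone_of_idealP; rewrite opprK.
  by move=> PNx; left; exact/cone_of_idealP.
- apply: contrapT => /forallNP cT; apply: Pproper; rewrite -suppE.
  by apply/seteqP; split=> // x _; split; apply: contrapT; exact: cT.
Qed.

Lemma cone_of_ideal_ge0 : [set x : A | 0 <= x] `<=` cone_of_ideal.
Proof.
by move=> x x0; exists x => //; rewrite subrr; have [[[]]] := PP.
Qed.

End LIdeal.

Section ConeIdeal.
Variable C : set A.
Hypotheses (coneC : prime_positive_cone (@rng_mul A) C)
  (C_ge0 : [set x : A | 0 <= x] `<=` C).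

(** For [x] in the support, primality puts the positive part of [x] or of [- x] there, hence both,
    since they differ by [x]. Joins and meets are then expressed through positive parts. *)
Lemma support_prime_l_ideal : prime_l_ideal (support C).
Proof.
have sN x : support C x -> support C (- x) by exact: supportN.
have sD x y : support C x -> support C y -> support C (x + y).
  exact: (supportD coneC).
have s0 : support C 0 by split; rewrite ?oppr0; exact: ppc0 coneC.
have s_pos x : support C x -> support C x^⁺.
  move=> sx; have : support C (x^⁺ ** (- x)^⁺) by rewrite pos_part_mul.
  case/(ppc_prime coneC) => // sNx.
  by rewrite -[x^⁺](subrK (- x)^⁺) pos_part_sub; exact: sD.
have join_pos x y : x ⊔ y = (x - y)^⁺ + y by rewrite lrng_joinD subrK add0r.
have meet_pos x y : x ⊓ y = x - (x - y)^⁺.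
  apply/le_anti/andP; split.
    rewrite lrng_leBrDr addrC -lrng_leBrDr lrng_joinP; apply/andP; split.
      rewrite lrng_leBrDr addrAC lrng_leBlDr addrC [leRHS]addrC -lrng_le_add.
      exact: lrng_meetr.
    by rewrite lrng_leBrDr add0r lrng_meetl.
  rewrite lrng_meetP; apply/andP; split.
    by rewrite lrng_leBlDr lrng_lerDl; exact: pos_part_ge0.
  by rewrite lrng_leBlDr addrC -lrng_leBlDr; exact: lrng_joinl.
split.
- split.
  + split=> // [x y sx sy|a x sx]; first by apply: sD => //; exact: sN.
    have sax := support_mull mC mDl coneC a sx.
    by split=> //; rewrite mC.
  + move=> x y z [Cx CNx] [Cz CNz] xy yz; split.
      rewrite -(subrK x y); apply: (ppcD coneC) => //; apply: C_ge0 => /=.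
      by rewrite lrng_leBrDr add0r.
    have -> : - y = (z - y) - z by rewrite addrAC subrr add0r.
    apply: (ppcD coneC) => //; apply: C_ge0 => /=.
    by rewrite lrng_leBrDr add0r.
  + move=> x y sx sy; have sxy : support C (x - y)^⁺.
      by apply/s_pos/sD => //; exact: sN.
    by rewrite join_pos meet_pos; split; apply: sD => //; exact: sN.
- have [x NCx] := ppc_proper coneC; move=> sT; apply: NCx.
  by have [] : support C x by rewrite sT.
- exact: ppc_prime coneC.
Qed.

Lemma cone_of_support : cone_of_ideal (support C) = C.
Proof.
apply/seteqP; split=> x.
  move=> [y y0 [Cxy _]]; rewrite -(subrK y x); apply: (ppcD coneC) => //.
  exact: C_ge0.
move=> Cx; have : support C (x^⁺ ** (- x)^⁺).
  by rewrite pos_part_mul; split; rewrite ?oppr0; exact: ppc0 coneC.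
case/(ppc_prime coneC) => [[_ CNxp]|sxn].
  exists 0 => //; rewrite subr0; split=> //.
  rewrite -[- x]pos_part_sub opprK; apply: (ppcD coneC) => //.
  exact/C_ge0/pos_part_ge0.
exists x^⁺; first exact: pos_part_ge0.
rewrite -{1}[x]pos_part_sub addrAC subrr add0r; exact: supportN.
Qed.

End ConeIdeal.

Lemma brumfiel_cone_space : cone_space (brumfiel_spectrum A).
Proof.
exists A, (@rng_mul A), [set x : A | 0 <= x],
  (fun P : brumfiel_spectrum A => cone_of_ideal (brumfiel_ideal P)).
have PP (P : brumfiel_spectrum A) := brumfiel_idealP P.
have suppE P := cone_of_ideal_support (PP P).
have coneP P := cone_of_ideal_prime (PP P).
split.
- by split=> //; exact: rng_mulA.
- by move=> P; split; [exact: coneP|exact: cone_of_ideal_ge0].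
- move=> Q coneQ Q0; exists (BrumfielPoint (support_prime_l_ideal coneQ Q0)).
  exact: cone_of_support.
split=> [a|F P FF DF V].
  change (brumfiel_closed (~` [set P : brumfiel_spectrum A |
    ~ cone_of_ideal (brumfiel_ideal P) a])).
  exists [set (- a)^⁺]; apply/seteqP; split=> P /=.
    by move=> /contrapT/(cone_of_idealP (PP P)) Pa _ ->.
  by move=> /(_ _ erefl)/(cone_of_idealP (PP P)) Ca /(_ Ca).
rewrite nbhsE => -[W [oW WP] WV].
have [I WI] : brumfiel_closed (~` W) by exact: oW.
(* Some [x] in [I] is outside [P], which is the support of its cone; so [x] or [- x] is outside the
   cone, and this gives a subbasic set inside [W]. *)
have [x [Ix NPx]] : exists x, I x /\ ~ brumfiel_ideal P x.
  apply: contrapT => /forallNP NI; suff : (~` W) P by [].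
  rewrite WI => x Ix; apply: contrapT => NPx; exact: (NI x).
have xW (Q : brumfiel_spectrum A) : ~ brumfiel_ideal Q x -> W Q.
  move=> NQx; apply: contrapT => NWQ; apply: NQx.
  by have : (~` W) Q by []; rewrite WI; apply.
have NQ (Q : brumfiel_spectrum A) y : brumfiel_ideal Q x -> y = x \/ y = - x ->
    cone_of_ideal (brumfiel_ideal Q) y.
  move=> Qx; have [Cx CNx] : support (cone_of_ideal (brumfiel_ideal Q)) x.
    by rewrite suppE.
  by move=> [->|->].
have FV y : y = x \/ y = - x ->
    F [set Q | ~ cone_of_ideal (brumfiel_ideal Q) y] -> F V.
  move=> yx; apply: filterS => Q NCy; apply/WV/xW => Qx; apply: NCy.
  exact: NQ Qx yx.
by move: NPx; rewrite -suppE => /not_andP[/DF|/DF]; apply: FV; [left|right].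
Qed.

End FRings.

(** * Preimages of cones, and signs of polynomials *)

Lemma ppc_preimage (R S : pzRingType) (P : set S) (f : R -> S) :
  zmod_morphism f -> {morph f : x y / x * y} -> f 1 = 1 -> ~ P (- 1) ->
  prime_positive_cone *%R P -> prime_positive_cone *%R (f @^-1` P).
Proof.
move=> fB fM f1 PN1 coneP.
have f0 : f 0 = 0 by rewrite -(subrr 0) fB subrr.
have fN x : f (- x) = - f x by rewrite -sub0r fB f0 sub0r.
have fD x y : f (x + y) = f x + f y by rewrite -{1}[y]opprK fB fN opprK.
split=> [x y|x y|x||x y]; rewrite /support /= ?(fD, fN, fM).
- exact: ppcD coneP _ _.
- exact: ppcM coneP _ _.
- exact: ppc_total coneP _.
- by exists (- 1); rewrite fN f1.
- exact: (@ppc_prime _ _ _ coneP (f x) (f y)).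
Qed.

Section LowCone.
Variables (R : idomainType) (P : set R).
Hypotheses (coneP : prime_positive_cone *%R P)
  (support0 : forall x, support P x -> x = 0).

(* The sign of a polynomial is that of its lowest nonzero coefficient. *)
Definition low_cone : set {poly R} :=
  [set p | forall k, (forall j, (j < k)%N -> p`_j = 0) -> P p`_k].

Lemma lowest_coef (p : {poly R}) : p != 0 ->
  exists2 m, p`_m != 0 & forall j, (j < m)%N -> p`_j = 0.
Proof.
move=> p0; have exm : exists m, p`_m != 0.
  by exists (size p).-1; rewrite -lead_coefE lead_coef_eq0.
case: (ex_minnP exm) => m pm mmin; exists m => // j jm; apply/eqP.
by apply: contraTT jm => /mmin; rewrite -leqNgt.
Qed.

Lemma low_cone_lowest (p : {poly R}) m : p`_m != 0 ->
  (forall j, (j < m)%N -> p`_j = 0) -> low_cone p <-> P p`_m.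
Proof.
move=> pm pj; split=> [/(_ m pj)//|Pm k pk].
have [km|mk|->//] := ltngtP k m; first by rewrite pj //; exact: ppc0 coneP.
by rewrite pk ?eqxx in pm.
Qed.

Lemma low_cone_support (p : {poly R}) : support low_cone p -> p = 0.
Proof.
move=> [lp lNp]; apply/polyP => k; rewrite coef0.
elim/ltn_ind: k => k IHk; apply: support0; split; first exact: lp.
by rewrite -coefN; apply: lNp => j /IHk; rewrite coefN => ->; rewrite oppr0.
Qed.

Lemma low_cone_prime : prime_positive_cone *%R low_cone.
Proof.
have low0 : low_cone 0 by move=> k _; rewrite coef0; exact: ppc0 coneP.
split.
- move=> p q lp lq k pqk.
  (* Below [k], by induction, the coefficients of [p] and [q] are nonnegative with sum zero, so both
     vanish. *)
  have pq0 j : (j < k)%N -> p`_j = 0 /\ q`_j = 0.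
    elim/ltn_ind: j => j IHj jk.
    have Pp : P p`_j.
      by apply: lp => i ij; have [] := IHj i ij (ltn_trans ij jk).
    have Pq : P q`_j.
      by apply: lq => i ij; have [] := IHj i ij (ltn_trans ij jk).
    have /eqP := pqk j jk; rewrite coefD addr_eq0 => /eqP pE.
    by split; apply: support0; split=> //; rewrite ?pE ?opprK // -pE.
  rewrite coefD; apply: (ppcD coneP).
    by apply: lp => j /pq0[].
  by apply: lq => j /pq0[].
- move=> p q lp lq.
  have [->|p0] := eqVneq p 0; first by rewrite mul0r.
  have [->|q0] := eqVneq q 0; first by rewrite mulr0.
  have [m pm pj] := lowest_coef p0; have [n qn qj] := lowest_coef q0.
  have pqmn : (p * q)`_(m + n) = p`_m * q`_n.
    have mlt : (m < (m + n).+1)%N by rewrite ltnS leq_addr.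
    rewrite coefM (bigD1 (Ordinal mlt)) //= addKn big1 ?addr0 // => i im.
    have [{}im|mi|mi] := ltngtP i m; first by rewrite pj ?mul0r.
      by rewrite qj ?mulr0 // ltn_subLR ?ltn_add2r // -ltnS.
    by move: im; rewrite -val_eqE /= mi eqxx.
  apply/(low_cone_lowest (m := (m + n)%N)); rewrite ?pqmn ?mulf_neq0 //.
    move=> k kmn; rewrite coefM big1 // => i _.
    have [im|mi] := ltnP i m; first by rewrite pj ?mul0r.
    rewrite qj ?mulr0 // ltn_subLR ?(leq_trans kmn) ?leq_add2r //.
    by rewrite -ltnS.
  apply: (ppcM coneP); first exact/(low_cone_lowest pm pj).
  exact/(low_cone_lowest qn qj).
- move=> p; have [->|p0] := eqVneq p 0; first by left.
  have [m pm pj] := lowest_coef p0.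
  have Npm : (- p)`_m != 0 by rewrite coefN oppr_eq0.
  have Npj j : (j < m)%N -> (- p)`_j = 0.
    by move=> /pj; rewrite coefN => ->; rewrite oppr0.
  have [Pm|PNm] := ppc_total coneP p`_m; [left|right].
    exact/(low_cone_lowest pm pj).
  by apply/(low_cone_lowest Npm Npj); rewrite coefN.
- exists (- 1) => /(_ 0 _); rewrite coefN coef1 /= => PN1.
  by apply: (ppc_notN1 coneP); exact: PN1.
- move=> p q /low_cone_support/eqP; rewrite mulf_eq0.
  by case/orP => /eqP->; [left|right]; split; rewrite ?oppr0.
Qed.

End LowCone.

(** * The ring of eventually constant families *)

Section EventuallyConstant.
Variables (I : choiceType) (R : comPzRingType).

(** [None] is the point at infinity of the one-point compactification of the discrete set [I], and
    [x None] is the limit value. *)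
Definition eventually_constant : {pred option I -> R} :=
  [pred x | `[< finite_set [set i | x (Some i) <> x None] >]].

Lemma eventually_constant_subring : subring_closed eventually_constant.
Proof.
split=> [|x y /asboolP fx /asboolP fy|x y /asboolP fx /asboolP fy];
  apply/asboolP.
- by apply: sub_finite_set (finite_set0 _) => i; apply.
- apply: (@sub_finite_set _ _ ([set i | x (Some i) <> x None] `|`
                                [set i | y (Some i) <> y None])).
    move=> i /=; apply: contra_notP => /not_orP[/contrapT xi /contrapT yi].
    by change (x (Some i) - y (Some i) = x None - y None); rewrite xi yi.
  by rewrite finite_setU.
- apply: (@sub_finite_set _ _ ([set i | x (Some i) <> x None] `|`
                                [set i | y (Some i) <> y None])).
    move=> i /=; apply: contra_notP => /not_orP[/contrapT xi /contrapT yi].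
    by change (x (Some i) * y (Some i) = x None * y None); rewrite xi yi.
  by rewrite finite_setU.
Qed.

HB.instance Definition _ := GRing.isSubringClosed.Build (option I -> R)
  eventually_constant eventually_constant_subring.

Record ec_fun := ECFun {
  ec_val :> option I -> R;
  _ : ec_val \in eventually_constant
}.

HB.instance Definition _ := [isSub for ec_val].
HB.instance Definition _ := [Choice of ec_fun by <:].
HB.instance Definition _ := 
  GRing.SubChoice_isSubComPzRing.Build _ _ ec_fun (subringClosedP _).

Lemma ec_finite (x : ec_fun) : finite_set [set i | x (Some i) <> x None].
Proof. by case: x => x /= /asboolP. Qed.

Definition ec_const (r : R) : ec_fun.
Proof.
exists (fun=> r); apply/asboolP.
by apply: sub_finite_set (finite_set0 _) => i; apply.
Defined.

(** The idempotent that isolates the fibre over [i]. *)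
Definition ec_delta (i : I) : ec_fun.
Proof.
exists (fun j => (j == Some i)%:R); apply/asboolP.
apply: (sub_finite_set _ (finite_set1 i)) => j /=.
by case: eqVneq => [[]|].
Defined.

Lemma ec_cone (P : set R) (j : option I) : prime_positive_cone *%R P ->
  prime_positive_cone *%R [set x : ec_fun | P (x j)].
Proof.
move=> coneP; apply: (ppc_preimage (f := fun x : ec_fun => x j)) => //.
exact: ppc_notN1.
Qed.

End EventuallyConstant.

(** * The chain of three cones in Z[t][s] *)

Local Notation bipoly := {poly {poly int}}.

Definition int_cone : set int := [set x | 0 <= x].
(** Here s is ['X] and t is ['X%:P]. The cone [cone0] is the order with 0 < s << t << 1; [cone1] and
    [cone2] contain it and have supports (s) and (s, t). *)
Definition cone0 : set bipoly := low_cone (low_cone int_cone).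
Definition cone1 : set bipoly := [set p : bipoly | low_cone int_cone p`_0].
Definition cone2 : set bipoly := [set p : bipoly | int_cone p`_0`_0].

Lemma int_cone_support x : support int_cone x -> x = 0.
Proof.
by move=> [x0]; rewrite /int_cone /= oppr_ge0 => Nx0; apply/le_anti/andP.
Qed.

Lemma int_cone_prime : prime_positive_cone *%R int_cone.
Proof.
split.
- by move=> x y; exact: addr_ge0.
- by move=> x y; exact: mulr_ge0.
- by move=> x; rewrite /int_cone /= oppr_ge0; apply/orP; exact: le_total.
- by exists (- 1).
- move=> x y /int_cone_support/eqP; rewrite mulf_eq0.
  by case/orP => /eqP ->; [left|right]; split; rewrite ?oppr0.
Qed.

Lemma coef0_cone (R : comNzRingType) (P : set R) :
  prime_positive_cone *%R P ->
  prime_positive_cone *%R [set p : {poly R} | P p`_0].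
Proof.
move=> coneP; apply: (ppc_preimage (f := coefp 0)) => //.
- exact: raddfB.
- exact: rmorphM.
- exact: rmorph1.
- exact: ppc_notN1.
Qed.

Lemma cone0_prime : prime_positive_cone *%R cone0.
Proof.
apply: low_cone_prime; last exact: low_cone_support int_cone_support.
exact: low_cone_prime int_cone_prime int_cone_support.
Qed.

Lemma cone1_prime : prime_positive_cone *%R cone1.
Proof. exact/coef0_cone/(low_cone_prime int_cone_prime int_cone_support). Qed.

Lemma cone2_prime : prime_positive_cone *%R cone2.
Proof.
apply: (coef0_cone (P := [set p : {poly int} | int_cone p`_0])).
exact/coef0_cone/int_cone_prime.
Qed.

Lemma cone0_sub1 : cone0 `<=` cone1.
Proof. by move=> p /(_ 0%N); apply. Qed.

Lemma cone1_sub2 : cone1 `<=` cone2.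
Proof. by move=> p /(_ 0%N); apply. Qed.

(** The variable s separates [cone0] from [cone1]; below, t separates [cone1] from [cone2]. *)
Lemma cone1_NX : cone1 (- 'X).
Proof. by move=> k _; rewrite coefN coefX oppr0 coef0 /int_cone /= lexx. Qed.

Lemma cone0_NX : ~ cone0 (- 'X).
Proof.
move=> /(_ 1%N); rewrite coefN coefX /= => NX.
have : low_cone int_cone (- 1).
  by apply: NX => -[|//] _; rewrite coefN coefX oppr0.
exact: ppc_notN1 (low_cone_prime int_cone_prime int_cone_support).
Qed.

Lemma cone2_NXC : cone2 (- ('X%:P)).
Proof. by rewrite /cone2 /int_cone /= coefN coefC /= coefN coefX oppr0. Qed.

Lemma cone1_NXC : ~ cone1 (- ('X%:P)).
Proof.
rewrite /cone1 /= coefN coefC /= => /(_ 1%N).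
rewrite coefN coefX /= => /(_ _); rewrite /int_cone /= => NX.
have : (0 : int) <= - 1 by apply: NX => -[|//] _; rewrite coefN coefX oppr0.
by [].
Qed.

(* [Outer b (Some i)] is [o0 i] or [o2 i]; [Outer b None] is [l0] or [l2];
   [Middle] is [l1]. *)
Inductive point (I : Type) := Outer of bool & option I | Middle.
Arguments Middle {I}.

(** * The space inside the real spectrum *)

Section Space.
Variable I : choiceType.
Local Notation R := (ec_fun I bipoly).

Definition position (p : point I) : option I :=
  if p is Outer _ j then j else None.

Definition level (p : point I) : set bipoly :=
  match p with
  | Outer false _ => cone0
  | Outer true _ => cone2
  | Middle => cone1
  end.

Definition point_cone (p : point I) : set R :=
  [set x | level p (x (position p))].

Lemma level_prime p : prime_positive_cone *%R (level p).
Proof.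
case: p => [[] j|]; [exact: cone2_prime|exact: cone0_prime|].
exact: cone1_prime.
Qed.

Lemma point_cone_prime p : prime_cone (point_cone p).
Proof. exact/prime_coneP/ec_cone/level_prime. Qed.

Definition point_real (p : point I) : real_spectrum R :=
  RealPoint (point_cone_prime p).

Definition point_space : set (real_spectrum R) := range point_real.

Definition to_space (p : point I) : point_space :=
  SigSub (mem_set (imageT point_real p)).

Lemma to_space_surj (t : point_space) : exists p, t = to_space p.
Proof.
by have [p _ pt] := set_valP t; exists p; exact/val_inj.
Qed.

(** This is patch closedness. A nonprincipal ultrafilter contains the range of some [Outer b] and
    avoids each single point, so it tends to [Outer b None]. *)
Lemma point_ultra_limit (U : set_system (point I)) : UltraFilter U ->
  exists p, forall x, U [set q | point_cone q x] <-> point_cone p x.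
Proof.
move=> UU.
have limit p S : U S -> (forall x, exists2 S', U S' & forall q, S q -> S' q ->
    (point_cone q x <-> point_cone p x)) ->
    forall x, U [set q | point_cone q x] <-> point_cone p x.
  move=> US + x => /(_ x)[S' US' SS']; split=> [Ux|px].
    have [q [[Sq S'q]]] := filter_ex (filterI (filterI US US') Ux).
    by move=> /(SS' q Sq S'q).
  by apply: filterS (filterI US US') => q [Sq S'q]; exact/(SS' q Sq S'q).
have [[p Up]|/forallNP Uprinc] := pselect (exists p, U [set p]).
  exists p; apply: limit Up _ => x; exists setT; first exact: filterT.
  by move=> q ->.
have outer b : U (range (Outer b)) ->
    exists p, forall x, U [set q | point_cone q x] <-> point_cone p x.
  move=> Ub; exists (Outer b None); apply: limit Ub _ => x.
  have /finite_fsetP[E xE] := ec_finite x.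
  (* [E] holds the finitely many indices where [x] differs from its limit value. *)
  exists (~` [set Outer b None] `&`
          \bigcap_(i in [set` E]) ~` [set Outer b (Some i)]).
    apply: filterI; first exact/ultra_setC.
    by apply: filter_bigI => i _; exact/ultra_setC.
  move=> _ [[i|] _ <-] [NN Ni]; last by case: NN.
  have -> : point_cone (Outer b (Some i)) x =
    level (Outer b None) (x (Some i)) by [].
  suff -> : x (Some i) = x None by [].
  apply: contrapT => xi; have : [set` E] i by rewrite -xE.
  by move=> /Ni; apply.
have [/outer//|Ntrue] := in_ultra_setVsetC (range (Outer true)) UU.
have [/outer//|Nfalse] := in_ultra_setVsetC (range (Outer false)) UU.
(* Only [Middle] lies outside both ranges, so [U] would be principal. *)
case: (Uprinc Middle); apply: filterS (filterI Ntrue Nfalse) => -[[] j|//].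
  by case=> -[]; exists j.
by case=> _ []; exists j.
Qed.

Lemma point_space_spectral : spectral_subspace point_space.
Proof.
apply: (spectral_subspace_patch (@real_subbase _)).
- move=> s t st; apply: real_cone_inj; apply/seteqP.
  by split=> x sx; apply: contrapT => /st.
- exact: real_ultra_limit.
- move=> U UU; have [r rE] := choice to_space_surj.
  have [p pU] := point_ultra_limit (ultra_fmap r UU).
  exists (to_space p) => x.
  have -> : (set_val @ U) [set P | ~ real_cone P x] =
      (r @ U) (~` [set q | point_cone q x]).
    congr U; apply/funext => t /=.
    by rewrite [in LHS](rE t).
  rewrite (ultra_setC _ (ultra_fmap r UU)).
  by split=> H /pU.
Qed.

Lemma point_space_not_cone_space : ~ countable [set: I] ->
  ~ cone_space (set_type point_space).
Proof.
move=> I_unc.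
have XT := subbase_preimage (@real_subbase R) point_space.
have lev_lim b W : open W -> W (to_space (Outer b None)) ->
    finite_set [set i | ~ W (to_space (Outer b (Some i)))].
  move=> oW Wb.
  pose F : set_system point_space :=
    [set V | finite_set (setT `&` [set i | ~ V (to_space (Outer b (Some i)))])].
  have FF : Filter F by exact: cofinite_filter.
  have : F --> to_space (Outer b None).
    apply: XT.2 => x xb.
    (* Each family takes its limit value at almost all [i]. *)
    apply: sub_finite_set (ec_finite x) => i [_ /contrapT xi] xE.
    by apply: xb; move: xi; rewrite /= /point_cone /= xE.
  move=> /(_ W (open_nbhs_nbhs (conj oW Wb))).
  by rewrite /F /= nbhs_filterE /= setTI.
have lev_spec p q W : position p = position q -> level p `<=` level q ->
    open W -> W (to_space q) -> W (to_space p).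
  move=> pq lpq oW Wq; apply: (subbase_open_transfer XT oW Wq) => x /= Nq Np.
  by apply: Nq; rewrite /point_cone /= -pq; exact: lpq.
apply: (@not_cone_space _ I
  (to_space \o Outer true \o Some) (to_space \o Outer false \o Some)
  (to_space (Outer false None)) (to_space Middle)
  (to_space (Outer true None))) => //.
- move=> t; have [[b [i|]|] ->] := to_space_surj t.
  + by left; exists i; case: b; [right|left].
  + by right; case: b; [exact: Or33|exact: Or31].
  + by right; exact: Or32.
- move=> i.
  (* The element evaluates to -1 over [i], outside every prime cone, and to 0 elsewhere, so this
     open set is exactly the fibre. *)
  exists (set_val @^-1` [set P | ~ real_cone P (- ec_delta bipoly i)]).
  have VP p : ~ point_cone p (- ec_delta bipoly i) <-> position p = Some i.
    change (~ level p (- (position p == Some i)%:R) <-> position p = Some i).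
    case: eqP => [pi|pi]; split=> //.
      by move=> _; rewrite mulr1n; exact: ppc_notN1 (level_prime p).
    by case; rewrite mulr0n oppr0; exact: ppc0 (level_prime p).
  split.
  + exact: XT.1.
  + exact/(VP (Outer true (Some i))).
  + move=> t; have [p ->] := to_space_surj t => /VP.
    by case: p => //= -[] j ->; [right|left].
  + by move=> j /(VP (Outer true (Some j)))[].
- move=> i W; apply: lev_spec => //=; exact: subset_trans cone0_sub1 cone1_sub2.
- by move=> W; apply: lev_spec => //; exact: cone0_sub1.
- by move=> W; apply: lev_spec => //; exact: cone1_sub2.
- exists (set_val @^-1` [set P | ~ real_cone P (ec_const I (- 'X))]); split.
  + exact: XT.1.
  + exact: cone0_NX.
  + by move=> /(_ cone1_NX).
- exists (set_val @^-1` [set P | ~ real_cone P (ec_const I (- 'X%:P))]); split.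
  + exact: XT.1.
  + exact: cone1_NXC.
  + by move=> /(_ cone2_NXC).
  + by move=> i /(_ cone2_NXC).
- by move=> W; exact: lev_lim.
- by move=> W; exact: lev_lim.
Qed.

End Space.

(** * An uncountable index set and the conclusion *)

(** Cantor's diagonal argument, applied to an injection [f] from sets of numbers to numbers. *)
Lemma set_nat_uncountable : ~ countable [set: set nat].
Proof.
move=> /countable_injP[f f_inj].
pose S : set nat := [set n | exists2 B, f B = n & ~ B n].
have [SfS|NSfS] := pselect (S (f S)); last by apply: (NSfS); exists S.
by case: (SfS) => B /f_inj BS; rewrite BS ?inE // => /(_ SfS).
Qed.

Theorem corollary5p10 :
  exists (R : comPzRingType) (X : set (real_spectrum R)),
    [/\ spectral_subspace X,
        forall A : comFRingType,
          ~ homeomorphic (set_type X) (brumfiel_spectrum A)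
      & forall S : comPzRingType,
          ~ homeomorphic (set_type X) (real_spectrum S)].
Proof.
exists (ec_fun (set nat) bipoly), (@point_space (set nat)).
have not_cone := @point_space_not_cone_space (set nat) set_nat_uncountable.
split=> [|A /homeomorphic_cone_space|S /homeomorphic_cone_space].
- exact: point_space_spectral.
- by move=> /(_ (brumfiel_cone_space A)).
- by move=> /(_ (real_cone_space S)).
Qed.
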